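(* A subset $B$ of a linear topological space $L$ is $\sigma$-convex if and only if $B$ is bounded and $\infty$-convex.
   Context: Linear topological spaces are over $\mathbb R$. A subset $B$ of a linear topological space $L$ is bounded if for each neighborhood $U\subset L$ of zero there is $n\in\mathbb N$ with $B\subset nU$. $B$ is $\sigma$-convex (resp. $\infty$-convex) if for each sequence (resp. each sequence bounded in $L$) $(x_n)_{n\in\mathbb N}$ of points of $B$ and each sequence $(t_n)_{n\in\mathbb N}$ of non-negative reals with $\sum_{n=1}^\infty t_n=1$ the series $\sum_{n=1}^\infty t_nx_n$ converges to some point of $B$. *)

(* Defs.v *)
From mathcomp Require Import all_boot all_order all_algebra.
From mathcomp Require Import all_classical all_reals all_analysis.

Set Implicit Arguments.
Unset Strict Implicit.
Unset Printing Implicit Defensive.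

Import GRing.Theory Num.Theory.
Import numFieldNormedType.Exports.

Local Open Scope classical_set_scope.
Local Open Scope ring_scope.

(* [bounded_set] of the library is stated with a norm; this is the notion for
   a topological vector space, which need not be locally convex, hence
   [topologicalLmodType] rather than [tvsType]. *)
Definition tvs_bounded (R : realType) (L : topologicalLmodType R)
    (B : set L) : Prop :=
  forall U : set L, nbhs (0 : L) U ->
    exists2 n : nat, (0 < n)%N & B `<=` [set n%:R *: u | u in U].

(* Sequences are indexed from 0 instead of 1. *)
Definition sigma_convex (R : realType) (L : topologicalLmodType R)
    (B : set L) : Prop :=
  forall (x : nat -> L) (t : nat -> R),
    (forall n, B (x n)) ->
    (forall n, 0 <= t n) -> series t @ \oo --> (1 : R) ->
    exists2 b : L, B b & series (fun n => t n *: x n) @ \oo --> b.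

Definition infty_convex (R : realType) (L : topologicalLmodType R)
    (B : set L) : Prop :=
  forall (x : nat -> L) (t : nat -> R),
    (forall n, B (x n)) -> tvs_bounded (range x) ->
    (forall n, 0 <= t n) -> series t @ \oo --> (1 : R) ->
    exists2 b : L, B b & series (fun n => t n *: x n) @ \oo --> b.

(* Main.v *)
(* If [B] is not absorbed by a neighborhood [U] of zero, pick points [x n] of
   [B] outside [2 ^ n.+1 U]. The terms of the series with weights
   [1 / 2 ^ n.+1] then all avoid [U], so the series diverges. *)

Require Import Defs.
From mathcomp Require Import all_boot all_order all_algebra.
From mathcomp Require Import all_classical all_reals all_analysis.

Import GRing.Theory Num.Theory.
Import numFieldNormedType.Exports.

Local Open Scope classical_set_scope.
Local Open Scope ring_scope.

Lemma tvs_boundedS (R : realType) (L : topologicalLmodType R) (A B : set L) :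
  A `<=` B -> tvs_bounded B -> tvs_bounded A.
Proof.
move=> AB Bbnd U /Bbnd[n n0 BU]; exists n => //.
exact: subset_trans AB BU.
Qed.

(* The library's [cvg_series_cvg_0] is restricted to normed modules. *)
Lemma topological_cvg_series_cvg_0 (M : topologicalZmodType) (u : nat -> M)
    (b : M) :
  series u @ \oo --> b -> u @ \oo --> (0 : M).
Proof.
move=> ub.
(* Each term is a difference of consecutive partial sums; both tend to [b], so continuity of
   subtraction gives the limit [b - b]. *)
have -> : u = (fun n => series u n.+1 - series u n).
  by apply/funext => n; rewrite seriesEnat /= big_nat_recr//= addrAC subrr add0r.
rewrite -(subrr b).
apply: (cvg_comp2 (f := fun n => series u n.+1) (h := fun x y : M => x - y)
  _ ub (@sub_continuous M (b, b))).
apply: (cvg_comp (fun n => n.+1) (series u) _ ub).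
by under eq_fun do rewrite -addn1; exact: cvg_addnr.
Qed.

Lemma sigma_convex_bounded (R : realType) (L : topologicalLmodType R)
    (B : set L) :
  sigma_convex B -> tvs_bounded B.
Proof.
move=> Bsigma U U0; apply: contrapT => /forall2NP BU.
have outside n : exists x, B x /\ ~ [set (2 ^ n.+1)%:R *: u | u in U] x.
  (* [BU] leaves two cases: the factor is not positive, impossible for a power of 2, or some point
     of [B] escapes. *)
  have [|/existsNP[x /not_implyP]] := BU (2 ^ n.+1)%N; last by exists x.
  by rewrite expn_gt0.
have [x xP] := choice outside.
have half : series (fun n => ((2 ^ n.+1)%:R : R)^-1) @ \oo --> (1 : R).
  (* Exponents start at 1, so the weights sum to 1 and not 2. *)
  have := @cvg_geometric_series_half R 1 0; rewrite expr0 divr1.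
  by under eq_fun do rewrite addn1 div1r.
have [||b _ xb] := Bsigma x _ _ _ half.
- by move=> n; case: (xP n).
- by move=> n; rewrite invr_ge0.
(* The terms eventually lie in [U]; multiplying term [N] by [2 ^ N.+1] puts [x N] back into the
   dilate it avoids. *)
have [N _ /(_ N (leqnn N)) UxN] := topological_cvg_series_cvg_0 _ _ _ xb _ U0.
have [_] := xP N; apply; exists ((2 ^ N.+1)%:R^-1 *: x N) => //.
by rewrite scalerA divff ?scale1r// pnatr_eq0 expn_eq0.
Qed.

Theorem proposition5p1 (R : realType) (L : topologicalLmodType R) (B : set L) :
  sigma_convex B <-> (tvs_bounded B /\ infty_convex B).
Proof.
split=> [Bsigma|[Bbnd Binfty] x t Bx].
  split; first exact: sigma_convex_bounded.
  by move=> x t Bx _; exact: Bsigma.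
(* A sequence in [B] inherits boundedness from [B]. *)
apply: Binfty => //; apply: tvs_boundedS Bbnd.
by move=> _ [n _ <-].
Qed.
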